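(* Let $d\ge 0$ and $n\ge 1$ be integers. Every $d$-regular bipartite graph on $n$ vertices has a spanning linear forest with at most $\frac{n}{d+1}$ paths.
   Context: Graphs are finite and simple. A linear forest of a graph $G$ is a subgraph of $G$ that is a collection of vertex-disjoint paths, where a single vertex counts as a path; it is spanning if it contains every vertex of $G$. The number of paths of a linear forest is its number of connected components (isolated vertices included). *)

(* Defs.v *)
From HB Require Import structures.
From mathcomp Require Import all_boot all_order all_algebra.
Set Implicit Arguments.
Unset Strict Implicit.
Unset Printing Implicit Defensive.

Record sgraph := SGraph {
  vertex :> finType;
  adj : rel vertex;
  adj_sym : symmetric adj;
  adj_irrefl : irreflexive adj
}.

Definition regular (d : nat) (G : sgraph) : Prop :=
  forall x : G, #|[set y : G | adj x y]| = d.

(* [A] and its complement are the two (possibly empty) colour classes. *)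
Definition bipartite (G : sgraph) : Prop :=
  exists A : {set G}, forall x y : G, adj x y -> (x \in A) != (y \in A).

Record subgraph (G : sgraph) := Subgraph {
  sverts : {set G};
  sadj : rel G;
  sadj_sym : symmetric sadj;
  sadj_adj : forall x y : G, sadj x y -> adj x y;
  sadj_verts : forall x y : G, sadj x y -> x \in sverts
}.

Definition spanning (G : sgraph) (F : subgraph G) : Prop := sverts F = [set: G].

(* A path is given by the sequence of its vertices; its edges join the
   consecutive ones. *)
Definition path_edge (T : eqType) (p : seq T) : rel T :=
  fun x y => infix [:: x; y] p || infix [:: y; x] p.

(* [F] is the union of the paths listed in [ps]; [uniq (flatten ps)] says both
   that no path repeats a vertex and that the paths are vertex-disjoint. *)
Definition linear_forest (G : sgraph) (F : subgraph G) : Prop :=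
  exists ps : seq (seq G),
    [/\ [::] \notin ps,
        uniq (flatten ps),
        forall x : G, (x \in sverts F) = (x \in flatten ps)
      & forall x y : G, sadj F x y = has (fun p => path_edge p x y) ps].

(* The number of connected components of [F], isolated vertices included. *)
Definition num_paths (G : sgraph) (F : subgraph G) : nat :=
  n_comp (sadj F) (sverts F).

(* Main.v *)
Require Import Defs.
From HB Require Import structures.
From mathcomp Require Import all_boot all_order all_algebra.
From mathcomp Require Import zify.
From Stdlib Require Import Classical.
Set Implicit Arguments.
Unset Strict Implicit.
Unset Printing Implicit Defensive.
Import Order.TTheory GRing.Theory Num.Theory.

(** Let A be one side of the bipartition and d >= 1, so 2|A| = n; choose a path
cover of G with the least number k of paths.  The sum over A of the degrees in a
cover with k paths is n - k.  Call a vertex of A of cover degree at most 1 a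
token.  If s is a token, y a neighbour of s in G but not in the cover, then some
edge yw of the cover can be exchanged for sy without changing the number of
paths (otherwise a smaller cover would exist), which makes w a token ([rotate]).
Let S be the set of the vertices that are tokens in some cover reachable by such
exchanges.  The claim, which gives the theorem because |S| <= |A|, is that k (d
+ 1) <= 2 |S|.

The claim is proved in a form suited to induction ([many_tokens]): exchanges
never move the tokens of a set H of held vertices, which are required to keep
cover degree exactly 1 and no longer count as tokens, and with t = k - |H| the
claim is t (d + 1) <= 2 |S|.

Every exchange removes and adds one edge between S and one vertex outside A, so
that for y outside A the number f(y) of cover neighbours of y in S is the same
in all reachable covers.  Comparing the sum of the f(y), which is 2 |S| - t,
with the sum of the numbers e(y) of all neighbours of y in S, which is d |S|,
gives a vertex y with 2 e(y) > d f(y) ([rich_vertex]).  As 1 <= f(y) and e(y) <=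
d, this forces f(y) = 1 and 2 e(y) >= d + 1 ([rich_vertex_bounds]).  Now y has
at most one cover neighbour outside S, and the edge to it is never exchanged.
Without this edge y is an end of its path, and each token adjacent to y must be
the other end of that path, since otherwise the two ends could be joined
([tokens_same_list]). Hence at most one neighbour of y is a token at any time.
Take a reachable cover in which some neighbour s of y is a token and hold s as
well: from there on no other neighbour of y becomes a token, so S loses at least
e(y) >= (d + 1) / 2 vertices while t drops by one, and induction applies. *)

(** * Consecutive pairs in lists of paths *)

Section Steps.
Variable T : eqType.
Implicit Types (p q l r : seq T) (ps : seq (seq T)) (x y u v : T).

(** The pairs of consecutive vertices of [p], oriented along [p]. *)
Definition steps p : seq (T * T) := zip p (behead p).

(** The edges of the paths of [ps], each oriented along its path. *)
Definition arcs ps : seq (T * T) := flatten (map steps ps).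

(** Adjacency in the union of the paths listed in [ps]. *)
Definition ev ps : rel T := fun x y => has (fun p => path_edge p x y) ps.

(** Lying on a common path of [ps]. *)
Definition same ps : rel T := fun x y => has (fun p => (x \in p) && (y \in p)) ps.

(** The symmetric relation whose only edge is [uv]. *)
Definition uedge u v : rel T := fun x y => ((x, y) == (u, v)) || ((x, y) == (v, u)).

Lemma size_steps p : size (steps p) = (size p).-1.
Proof. by rewrite size_zip size_behead; case: p => //= a p; lia. Qed.

Lemma steps_cat p u v q :
  steps (rcons p u ++ v :: q) = steps (rcons p u) ++ (u, v) :: steps (v :: q).
Proof.
elim: p => [|a p IH] //=.
case: p IH => [|b p] //= IH.
by move: IH; rewrite /steps /= => ->.
Qed.

Lemma unzip2_steps p : unzip2 (steps p) = behead p.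
Proof. by apply: unzip2_zip; rewrite size_behead leq_pred. Qed.

Lemma unzip1_steps p : subseq (unzip1 (steps p)) p.
Proof.
elim: p => //= a [|b p] //=; rewrite /steps /= => IH.
by rewrite eqxx.
Qed.

Lemma stepsP p x y :
  reflect (exists l r, p = l ++ [:: x, y & r]) ((x, y) \in steps p).
Proof.
apply: (iffP idP) => [|[l [r ->]]].
  elim: p => //= a [|b p] //= IH; rewrite /steps /= inE => /orP[/eqP[-> ->]|].
    by exists [::], p.
  by move=> /IH[l [r ->]]; exists (a :: l), r.
by rewrite -cat_rcons steps_cat mem_cat inE eqxx orbT.
Qed.

Lemma infix_steps p x y : infix [:: x; y] p = ((x, y) \in steps p).
Proof.
apply/idP/stepsP => [/infixP[l [r ->]]|[l [r ->]]]; first by exists l, r.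
by apply/infixP; exists l, r.
Qed.

Lemma ev_arcs ps x y : ev ps x y = ((x, y) \in arcs ps) || ((y, x) \in arcs ps).
Proof.
rewrite /ev /arcs; elim: ps => //= p ps ->.
rewrite /path_edge !infix_steps !mem_cat.
by do 2!case: (_ \in steps p) => //=; rewrite ?orbT.
Qed.

Lemma ev_sym ps : symmetric (ev ps).
Proof. by move=> x y; rewrite !ev_arcs orbC. Qed.

Lemma same_sym ps : symmetric (same ps).
Proof. by move=> x y; rewrite /same; apply: eq_has => p; rewrite andbC. Qed.

Lemma uedge_sym u v : symmetric (uedge u v).
Proof. by move=> x y; rewrite /uedge !xpair_eqE orbC; congr (_ || _); rewrite andbC. Qed.

Lemma uedgeC u v : uedge u v =2 uedge v u.
Proof. by move=> x y; rewrite /uedge orbC. Qed.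

Lemma uniq_unzip1_arcs ps : uniq (flatten ps) -> uniq (unzip1 (arcs ps)).
Proof.
apply: subseq_uniq; rewrite /arcs; elim: ps => //= p ps IH.
by rewrite /unzip1 map_cat cat_subseq ?unzip1_steps.
Qed.

Lemma uniq_unzip2_arcs ps : uniq (flatten ps) -> uniq (unzip2 (arcs ps)).
Proof.
apply: subseq_uniq; rewrite /arcs; elim: ps => //= p ps IH.
rewrite /unzip2 map_cat cat_subseq //.
by rewrite -/(unzip2 _) unzip2_steps -drop1 drop_subseq.
Qed.

Lemma uniq_fst (s : seq (T * T)) x y z :
  uniq (unzip1 s) -> (x, y) \in s -> (x, z) \in s -> y = z.
Proof.
elim: s => //= [[a b] s] IH /= /andP[na us]; rewrite !inE !xpair_eqE.
move=> /orP[/andP[/eqP e1 /eqP e2]|h1] /orP[/andP[/eqP e3 /eqP e4]|h2].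
- by rewrite e2 e4.
- by case/negP: na; rewrite -e1 (map_f fst h2).
- by case/negP: na; rewrite -e3 (map_f fst h1).
- exact: IH.
Qed.

Lemma uniq_snd (s : seq (T * T)) x y z :
  uniq (unzip2 s) -> (y, x) \in s -> (z, x) \in s -> y = z.
Proof.
elim: s => //= [[a b] s] IH /= /andP[na us]; rewrite !inE !xpair_eqE.
move=> /orP[/andP[/eqP e1 /eqP e2]|h1] /orP[/andP[/eqP e3 /eqP e4]|h2].
- by rewrite e1 e3.
- by case/negP: na; rewrite -e2 (map_f snd h2).
- by case/negP: na; rewrite -e4 (map_f snd h1).
- exact: IH.
Qed.

Lemma size_arcs ps : [::] \notin ps -> (size (arcs ps) + size ps)%N = size (flatten ps).
Proof.
rewrite /arcs; elim: ps => //= p ps IH; rewrite inE negb_or => /andP[pn /IH e].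
rewrite !size_cat -e size_steps; case: p pn {IH e} => //= a p _; lia.
Qed.

Lemma ev_same ps x y : ev ps x y -> same ps x y.
Proof.
case/hasP=> p ip; rewrite /path_edge => h; apply/hasP; exists p => //.
by case/orP: h; rewrite infix_steps => /stepsP[l [r ->]];
  rewrite !mem_cat !inE !eqxx !orbT.
Qed.

Lemma ev_infix ps l r x y : (l ++ [:: x, y & r]) \in ps -> ev ps x y.
Proof.
by move=> h; apply/hasP; eexists; first exact: h; rewrite /path_edge !infix_steps;
  apply/orP; left; apply/stepsP; exists l, r.
Qed.

Lemma uniq_list ps p q x : uniq (flatten ps) ->
  p \in ps -> q \in ps -> x \in p -> x \in q -> p = q.
Proof.
elim: ps => //= a ps IH; rewrite cat_uniq => /and3P[_ /hasPn h u].
rewrite !inE => /orP[/eqP->|hp] /orP[/eqP->|hq] // xp xq.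
- have /h/negP[] // : x \in flatten ps by apply/flattenP; exists q.
- have /h/negP[] // : x \in flatten ps by apply/flattenP; exists p.
- exact: IH.
Qed.

(** Concatenating two paths of a list adds exactly one edge. *)
Lemma ev_glue l u v r ps :
  ev ((rcons l u ++ v :: r) :: ps) =2
  (fun x y => ev (rcons l u :: (v :: r) :: ps) x y || uedge u v x y).
Proof.
move=> x y; rewrite !ev_arcs /arcs /= steps_cat !mem_cat !inE /uedge.
have -> : ((x, y) == (v, u)) = ((y, x) == (u, v)) by rewrite !xpair_eqE andbC.
by repeat case: (_ \in _) => //=; repeat case: (_ == _).
Qed.

Lemma same_glue p q ps x y : same (p :: q :: ps) x y -> same ((p ++ q) :: ps) x y.
Proof.
by rewrite /same /= !mem_cat; repeat case: (_ \in _) => //=.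
Qed.

Lemma nsame_glue p q ps x y : uniq (flatten (p :: q :: ps)) ->
  x \in p -> y \in q -> ~~ same (p :: q :: ps) x y.
Proof.
move=> un xp yq; apply/negP=> /hasP[a ia /andP[xa ya]].
have e1 : a = p by apply: (uniq_list (x := x) un) => //; rewrite !inE eqxx.
have e2 : a = q by apply: (uniq_list (x := y) un) => //; rewrite !inE eqxx orbT.
move: un; rewrite /= cat_uniq => /and3P[_ /hasPn h _].
have /h/negP[] // : x \in q ++ flatten ps by rewrite mem_cat -e2 xa.
Qed.

End Steps.

(** * Path covers *)

Section Covers.
Variable G : sgraph.
Implicit Types (p q l r : seq G) (ps : seq (seq G)) (x y u v s w : G).

(** [ps] is a path cover of [G]: nonempty, vertex-disjoint paths of [G] that
together contain every vertex. *)
Definition valid ps : bool :=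
  [&& [::] \notin ps, uniq (flatten ps), [forall x, x \in flatten ps]
    & all (sorted (@adj G)) ps].

(** The degree of [x] in the graph with adjacency [e]. *)
Definition deg (e : rel G) x : nat := #|[set y | e x y]|.

Lemma adj_neq x y : adj x y -> x != y.
Proof. by apply: contraTneq => ->; rewrite adj_irrefl. Qed.

Lemma valid_uniq ps : valid ps -> uniq (flatten ps).
Proof. by case/and4P. Qed.

Lemma valid_nil ps : valid ps -> [::] \notin ps.
Proof. by case/and4P. Qed.

Lemma valid_mem ps x : valid ps -> exists2 p, p \in ps & x \in p.
Proof. by case/and4P=> _ _ /forallP h _; apply/flattenP. Qed.

Lemma sorted_steps p x y : sorted (@adj G) p -> (x, y) \in steps p -> adj x y.
Proof.
move=> sp /stepsP[l [r e]]; move: sp; rewrite e.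
by case: l {e} => [|a l] /=; [case/andP|rewrite cat_path /= => /and4P[]].
Qed.

Lemma valid_adj ps x y : valid ps -> ev ps x y -> adj x y.
Proof.
case/and4P=> _ _ _ /allP h /hasP[p /h sp]; rewrite /path_edge !infix_steps.
by case/orP => /(sorted_steps sp) //; rewrite adj_sym.
Qed.

Lemma deg_add_edge (e e' : rel G) u v x : u != v ->
  ~~ e' u v -> ~~ e' v u -> e =2 (fun x y => e' x y || uedge u v x y) ->
  deg e x = (deg e' x + (x == u) + (x == v))%N.
Proof.
move=> uv n1 n2 E; rewrite /deg.
have -> : [set y | e x y] = [set y | e' x y] :|: [set y | uedge u v x y].
  by apply/setP=> y; rewrite !inE E.
rewrite cardsU.
have -> : [set y | e' x y] :&: [set y | uedge u v x y] = set0.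
  apply/setP=> y; rewrite !inE; apply/negbTE/negP=> /andP[h].
  by rewrite /uedge !xpair_eqE => /orP[] /andP[/eqP e1 /eqP e2];
    move: h; rewrite e1 e2 ?(negbTE n1) ?(negbTE n2).
rewrite cards0 subn0 -addnA; congr addn.
case: (eqVneq x u) => [->|xu].
  rewrite (negbTE uv) addn0 (_ : [set y | _] = [set v]) ?cards1 //.
  by apply/setP=> y; rewrite !inE /uedge !xpair_eqE eqxx (negbTE uv) orbF.
case: (eqVneq x v) => [->|xv].
  rewrite (_ : [set y | _] = [set u]) ?cards1 //.
  by apply/setP=> y; rewrite !inE /uedge !xpair_eqE eqxx eq_sym (negbTE uv).
rewrite (_ : [set y | _] = set0) ?cards0 //.
by apply/setP=> y; rewrite !inE /uedge !xpair_eqE (negbTE xu) (negbTE xv).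
Qed.

Lemma deg_ge1 (e : rel G) x y : e x y -> (1 <= deg e x)%N.
Proof. by move=> h; rewrite card_gt0; apply/set0Pn; exists y; rewrite inE. Qed.

Lemma deg_le1_eq (e : rel G) x y z : (deg e x <= 1)%N -> e x y -> e x z -> y = z.
Proof.
by move=> /card_le1_eqP h xy xz; apply: h; rewrite inE.
Qed.

(** A vertex has at most one successor and at most one predecessor. *)
Lemma deg_le2 ps x : valid ps -> (deg (ev ps) x <= 2)%N.
Proof.
move=> V; rewrite /deg.
have -> : [set y | ev ps x y] =
  [set y | (x, y) \in arcs ps] :|: [set y | (y, x) \in arcs ps].
  by apply/setP=> y; rewrite !inE ev_arcs.
apply: leq_trans (leq_card_setU _ _) _.
apply: (@leq_add _ _ 1 1); apply/card_le1_eqP=> a b; rewrite !inE => ha hb.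
- exact: uniq_fst (uniq_unzip1_arcs (valid_uniq V)) hb ha.
- exact: uniq_snd (uniq_unzip2_arcs (valid_uniq V)) hb ha.
Qed.

(** [ps] and [ps'] cannot be told apart by [valid], the number of paths, adjacency
and lying on a common path; so it is for lists that differ in the order of the
paths or in the direction in which a path is listed. *)
Definition equiv ps ps' : Prop :=
  [/\ valid ps = valid ps', size ps = size ps', ev ps =2 ev ps' & same ps =2 same ps'].

Lemma equiv_trans a b c : equiv a b -> equiv b c -> equiv a c.
Proof.
case=> h1 h2 h3 h4 [k1 k2 k3 k4]; split; rewrite ?h1 ?h2 //.
- by move=> x y; rewrite h3.
- by move=> x y; rewrite h4.
Qed.

Lemma equiv_perm ps ps' : perm_eq ps ps' -> equiv ps ps'.
Proof.
move=> h; have hm := perm_mem h; split.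
- have hf : perm_eq (flatten ps) (flatten ps') by apply: perm_flatten.
  rewrite /valid hm (perm_uniq hf) (eq_all_r hm); congr [&& _, _, _ & _].
  by apply: eq_forallb => x; rewrite (perm_mem hf).
- exact: perm_size.
- by move=> x y; rewrite /ev (eq_has_r hm).
- by move=> x y; rewrite /same (eq_has_r hm).
Qed.

Lemma path_edge_rev p x y : path_edge (rev p) x y = path_edge p x y.
Proof.
have h (a b : G) : infix [:: a; b] (rev p) = infix [:: b; a] p.
  exact: (infix_rev [:: b; a] p).
by rewrite /path_edge !h orbC.
Qed.

Lemma equiv_rev p ps : equiv (p :: ps) (rev p :: ps).
Proof.
split=> //.
- rewrite /valid !inE /= !cat_uniq rev_uniq rev_sorted.
  have -> : ([::] == rev p) = ([::] == p).
    by apply/eqP/eqP=> [/(congr1 rev)|<- //]; rewrite revK.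
  congr [&& _, [&& _, _ & _], _ & _ && _].
  - by congr (~~ _); apply: eq_has => x; rewrite mem_rev.
  - by apply: eq_forallb => x; rewrite !mem_cat mem_rev.
  - by case: p => // a p; apply: eq_path => x y; rewrite adj_sym.
- by move=> x y; rewrite /ev /= path_edge_rev.
- by move=> x y; rewrite /same /= !mem_rev.
Qed.

Lemma equiv_front p ps : p \in ps -> exists rest, equiv ps (p :: rest).
Proof. by move=> h; exists (rem p ps); apply: equiv_perm; apply: perm_to_rem. Qed.

Lemma equiv_rev2 p q ps : equiv (p :: q :: ps) (p :: rev q :: ps).
Proof.
apply: (@equiv_trans _ (q :: p :: ps)).
  by apply: equiv_perm; rewrite (perm_catCA [:: p] [:: q] ps).
apply: (@equiv_trans _ (rev q :: p :: ps)); first exact: equiv_rev.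
by apply: equiv_perm; rewrite (perm_catCA [:: rev q] [:: p] ps).
Qed.

Lemma valid_glue l u v r ps :
  valid ((rcons l u ++ v :: r) :: ps) = valid (rcons l u :: (v :: r) :: ps) && adj u v.
Proof.
have -> : valid ((rcons l u ++ v :: r) :: ps) =
  [&& [::] \notin ps, uniq (flatten (rcons l u :: (v :: r) :: ps)),
      [forall x, x \in flatten (rcons l u :: (v :: r) :: ps)],
      sorted (@adj G) (rcons l u ++ v :: r) & all (sorted (@adj G)) ps].
  by rewrite /valid /= inE -catA; case: l.
have -> : valid (rcons l u :: (v :: r) :: ps) =
  [&& [::] \notin ps, uniq (flatten (rcons l u :: (v :: r) :: ps)),
      [forall x, x \in flatten (rcons l u :: (v :: r) :: ps)],
      sorted (@adj G) (rcons l u), path (@adj G) v r & all (sorted (@adj G)) ps].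
  by rewrite /valid !inE; case: l.
have -> : sorted (@adj G) (rcons l u ++ v :: r) =
   sorted (@adj G) (rcons l u) && adj u v && path (@adj G) v r.
  by case: l => [|a l] //=; rewrite cat_path last_rcons /= andbA.
move: (sorted _ (rcons l u)) (adj u v) (path _ v r) => b1 b2 b3.
by rewrite -!andbA; do 3!congr andb; case: b1 b2 b3 => [] [] [];
  rewrite /= ?andbF ?andbT.
Qed.

End Covers.

(** * Splitting, joining and exchanging edges *)

Section Moves.
Variable G : sgraph.
Implicit Types (p q l r : seq G) (ps : seq (seq G)) (x y u v s w : G).

Lemma unglue ps l u v r rest : valid ps ->
  equiv ps ((rcons l u ++ v :: r) :: rest) ->
  let ps' := rcons l u :: (v :: r) :: rest in
  [/\ valid ps', size ps' = (size ps).+1,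
      ev ps =2 (fun x y => ev ps' x y || uedge u v x y),
      {in rcons l u & v :: r, forall x y, ~~ same ps' x y}
    & forall x y, same ps' x y -> same ps x y].
Proof.
move=> V [Ev Es Ee Ec] ps'.
have /andP[V' _] : valid ps' && adj u v by rewrite -valid_glue -Ev.
split=> //.
- by rewrite Es.
- by move=> x y; rewrite Ee ev_glue.
- by move=> x y hx hy; apply: nsame_glue => //; apply: valid_uniq V'.
- by move=> x y h; rewrite Ec; apply: same_glue.
Qed.

Lemma uedge_or u v x y : uedge u v x y -> (x = u /\ y = v) \/ (x = v /\ y = u).
Proof. by rewrite /uedge !xpair_eqE => /orP[] /andP[/eqP-> /eqP->]; [left|right]. Qed.

Lemma uedge_refl u v : uedge u v u v.
Proof. by rewrite /uedge eqxx. Qed.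

Lemma split_edge ps u v : valid ps -> ev ps u v ->
  exists ps', [/\ valid ps', size ps' = (size ps).+1,
      ev ps =2 (fun x y => ev ps' x y || uedge u v x y), ~~ same ps' u v
    & forall x y, same ps' x y -> same ps x y].
Proof.
move=> V; rewrite ev_arcs => h.
wlog: u v h / (u, v) \in arcs ps.
  move=> W; case/orP: (h) => h'; first exact: W.
  case: (W v u) => // [|ps' [h1 h2 h3 h4 h5]]; first by rewrite orbC.
  exists ps'; split=> //; last by rewrite same_sym.
  by move=> x y; rewrite h3 (uedgeC v u).
move=> /flattenP[a /mapP[p ip ->]] /stepsP[l [r e]].
case: (equiv_front ip) => rest; rewrite e -cat_rcons => E.
case: (unglue V E) => h1 h2 h3 h4 h5.
by eexists; split; [exact: h1|exact: h2|exact: h3| |exact: h5];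
  apply: h4; rewrite ?mem_rcons inE eqxx.
Qed.

(** A vertex of degree at most 1 is an end of its path, as an interior vertex has
two distinct neighbours. *)
Lemma end_list ps p x : valid ps -> p \in ps -> x \in p -> (deg (ev ps) x <= 1)%N ->
  (exists r, p = x :: r) \/ (exists l, p = rcons l x).
Proof.
move=> V ip xp dx.
case/splitPr: xp ip => l r ip.
case: r ip => [|b r] ip; first by right; exists l; rewrite cats1.
case/lastP: l ip => [|l a] ip; first by left; exists (b :: r).
have hb : ev ps x b by apply: ev_infix ip.
have ha : ev ps x a by rewrite ev_sym; apply: (@ev_infix _ _ l (b :: r)); rewrite -cat_rcons.
have eab := deg_le1_eq dx ha hb.
have := valid_uniq V; case: (equiv_front ip) => rest [Ev _ _ _] _.
have /valid_uniq : valid ((rcons l a ++ [:: x, b & r]) :: rest) by rewrite -Ev.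
rewrite /= cat_uniq => /and3P[+ _ _].
by rewrite cat_uniq => /and3P[_ /hasPn/(_ b)];
  rewrite !inE eqxx orbT mem_rcons -eab inE eqxx => /(_ isT).
Qed.

Lemma equiv_front2 p q ps : p \in ps -> q \in ps -> q != p ->
  exists rest, equiv ps (p :: q :: rest).
Proof.
move=> ip iq qp; exists (rem q (rem p ps)); apply: equiv_perm.
have h := perm_to_rem ip; apply: perm_trans h _; rewrite perm_cons.
apply: perm_to_rem; move: iq; rewrite (perm_mem (perm_to_rem ip)) inE.
by rewrite (negbTE qp).
Qed.

(** Two path ends on different paths can be joined. *)
Lemma join_edge ps u v : valid ps -> adj u v ->
  (deg (ev ps) u <= 1)%N -> (deg (ev ps) v <= 1)%N -> ~~ same ps u v ->
  exists ps', [/\ valid ps', (size ps').+1 = size ps &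
    ev ps' =2 (fun x y => ev ps x y || uedge u v x y)].
Proof.
move=> V a du dv ns.
case: (valid_mem u V) => p ip up; case: (valid_mem v V) => q iq vq.
have qp : q != p.
  by apply: contraNneq ns => e; apply/hasP; exists p; rewrite ?up -?e.
case: (equiv_front2 ip iq qp) => rest E.
have [l [r F]] : exists l r, equiv ps (rcons l u :: (v :: r) :: rest).
  have [l E1] : exists l, equiv ps (rcons l u :: q :: rest).
    case: (end_list V ip up du) => [[r e]|[l e]]; last by exists l; rewrite -e.
    exists (rev r); rewrite -rev_cons -e.
    exact: equiv_trans E (equiv_rev _ _).
  exists l; case: (end_list V iq vq dv) => [[r e]|[r e]]; first by exists r; rewrite -e.
  exists (rev r); rewrite -rev_rcons -e.
  exact: equiv_trans E1 (equiv_rev2 _ _ _).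
case: F => Fv Fs Fe _.
exists ((rcons l u ++ v :: r) :: rest); split.
- by rewrite valid_glue -Fv V.
- by rewrite Fs.
- by move=> x y; rewrite ev_glue Fe.
Qed.

(** A path has at most two ends. *)
Lemma ends_same_list ps x y z : valid ps ->
  (deg (ev ps) x <= 1)%N -> (deg (ev ps) y <= 1)%N -> (deg (ev ps) z <= 1)%N ->
  same ps x y -> same ps x z -> x != y -> x != z -> y != z -> False.
Proof.
move=> V dx dy dz /hasP[p ip /andP[xp yp]] /hasP[q iq /andP[xq zq]].
have e := uniq_list (valid_uniq V) ip iq xp xq; subst q.
have hl w : w \in p -> (deg (ev ps) w <= 1)%N -> w = head x p \/ w = last x p.
  by move=> wp dw; case: (end_list V ip wp dw) => [[r ->]|[l ->]];
    [left|right; rewrite last_rcons].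
move: (head x p) (last x p) hl => H L hl.
by case: (hl x xp dx) => ->; case: (hl y yp dy) => ->; case: (hl z zq dz) => ->;
  rewrite eqxx.
Qed.

Lemma isolated ps x y : valid ps -> deg (ev ps) x = 0%N -> same ps x y -> x = y.
Proof.
move=> V d0 /hasP[p ip /andP[xp yp]].
have nox w : ~~ ev ps x w.
  by apply/negP=> /deg_ge1; rewrite d0.
case/splitPr: xp ip yp => l r ip.
case: r ip => [|b r] ip; last by case/negP: (nox b); apply: ev_infix ip.
case/lastP: l ip => [|l a] ip; first by rewrite inE => /eqP.
by case/negP: (nox a); rewrite ev_sym; apply: (@ev_infix _ _ l [::]); rewrite -cat_rcons.
Qed.

(** If [s] is a path end and [sy] an edge outside the cover, then [sy] can be
exchanged for some edge [yw], unless there is a smaller cover.  When [s] and [y]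
lie on the same path, [w] is the neighbour of [y] towards [s]. *)
Lemma rotate ps s y : valid ps -> adj s y -> ~~ ev ps s y -> (deg (ev ps) s <= 1)%N ->
  (exists w ps', [/\ ev ps y w, valid ps', size ps' = size ps &
     ev ps' =2 (fun a b => (ev ps a b && ~~ uedge y w a b) || uedge s y a b)])
  \/ (exists ps', valid ps' /\ (size ps' < size ps)%N).
Proof.
move=> V a ne ds.
have sy := adj_neq a.
(* It suffices to separate [s] from [y] by deleting an edge at [y], since then
     both are ends, on different paths. *)
have key w ps1 : valid ps1 -> ev ps y w -> size ps1 = (size ps).+1 ->
    ev ps =2 (fun a b => ev ps1 a b || uedge y w a b) -> ~~ same ps1 y w ->
    ~~ same ps1 s y ->
    exists w ps', [/\ ev ps y w, valid ps', size ps' = size ps &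
     ev ps' =2 (fun a b => (ev ps a b && ~~ uedge y w a b) || uedge s y a b)].
  move=> V1 yw s1 E1 nyw nsy.
  have n1 : ~~ ev ps1 y w by apply: contra nyw; apply: ev_same.
  have n2 : ~~ ev ps1 w y by rewrite ev_sym.
  have yw' : y != w by apply: adj_neq (valid_adj V yw).
  have D x := deg_add_edge x yw' n1 n2 E1.
  have ds1 : (deg (ev ps1) s <= 1)%N by apply: leq_trans ds; rewrite D -addnA leq_addr.
  have dy1 : (deg (ev ps1) y <= 1)%N.
    by have := deg_le2 y V; rewrite D eqxx (negbTE yw') addn0 addn1.
  case: (join_edge V1 a ds1 dy1 nsy) => ps' [V' s' E'].
  exists w, ps'; split=> //; first by apply/eqP; rewrite -eqSS s' s1.
  move=> b c; rewrite E' E1; congr (_ || _).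
  case u: (uedge y w b c); last by rewrite orbF andbT.
  rewrite orbT andbF.
  by case: (uedge_or u) => [[-> ->]|[-> ->]]; apply: negbTE.
case h: (same ps s y); last first.
  case: (posnP (deg (ev ps) y)) => [d0|].
    right; case: (join_edge V a ds _ (negbT h)) => [|ps' [V' s' _]]; first by rewrite d0.
    by exists ps'; rewrite V' -s'.
  rewrite card_gt0 => /set0Pn[w]; rewrite inE => yw; left.
  case: (split_edge V yw) => ps1 [V1 s1 E1 n1 m1].
  apply: (key w ps1) => //.
  by apply/negP=> /m1; rewrite h.
left; case/hasP: h => q iq /andP[sq yq].
case/splitPr: yq iq sq => l r iq; rewrite mem_cat inE (negbTE sy) /=.
case/orP=> [sl|sr].
  case/lastP: l iq sl => [|l w] // iq sl.
  case: (equiv_front iq) => rest E; case: (unglue V E) => V1 s1 E1 n1 _.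
  apply: (key w _ V1 _ s1).
  - by rewrite ev_sym; apply: (@ev_infix _ _ l r); rewrite -cat_rcons.
  - by move=> b c; rewrite E1 uedgeC.
  - by rewrite same_sym; apply: n1; rewrite ?mem_rcons inE eqxx.
  - by apply: n1; rewrite // inE eqxx.
case: r iq sr => [|w r] // iq sr.
case: (equiv_front iq) => rest; rewrite -cat_rcons => E.
case: (unglue V E) => V1 s1 E1 n1 _.
apply: (key w _ V1 _ s1 E1).
- exact: ev_infix iq.
- by apply: n1; rewrite ?mem_rcons inE eqxx.
- by rewrite same_sym; apply: n1; rewrite // mem_rcons inE eqxx.
Qed.

End Moves.

(** * Degree sums *)

Section Counting.
Variable G : sgraph.
Variable A : {set G}.
Hypothesis bipA : forall x y : G, adj x y -> (x \in A) != (y \in A).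
Implicit Types (ps : seq (seq G)) (x y u v s w : G).

Lemma sum_pred1 u : (\sum_(a in A) (a == u))%N = (u \in A).
Proof.
case uA: (u \in A).
  by rewrite (bigD1 u) //= eqxx big1 // => a /andP[_ /negbTE->].
by apply: big1 => a aA; case: eqP => // e; rewrite -e aA in uA.
Qed.

Lemma size_cover ps : valid ps -> (size (arcs ps) + size ps)%N = #|G|.
Proof.
move=> V; rewrite size_arcs ?valid_nil // -(card_uniqP (valid_uniq V)).
by apply: eq_card => x; case/and4P: V => _ _ /forallP -> _.
Qed.

(** Every edge of a cover has exactly one end in [A], so this sum counts the edges
of the cover; removing an edge adds a path. *)
Lemma sum_deg ps : valid ps -> (\sum_(a in A) deg (ev ps) a + size ps)%N = #|G|.
Proof.
have [m] := ubnP (size (arcs ps)); elim: m ps => // m IH ps hm V.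
(* Induct on the number of edges, splitting one off by [split_edge]. *)
case E: (arcs ps) => [|[u v] t].
  rewrite big1 ?add0n => [|a _]; first by have := size_cover V; rewrite E.
  apply/eqP; rewrite cards_eq0; apply/eqP/setP=> y.
  by rewrite !inE ev_arcs E.
have uv : ev ps u v by rewrite ev_arcs E inE eqxx.
case: (split_edge V uv) => ps' [V' s' E' n' _].
have n1 : ~~ ev ps' u v by apply: contra n'; apply: ev_same.
have n2 : ~~ ev ps' v u by rewrite ev_sym.
have auv := valid_adj V uv.
under eq_bigr => a _ do rewrite (deg_add_edge a (adj_neq auv) n1 n2 E').
have c1 := size_cover V; have c2 := size_cover V'.
have hs : (size (arcs ps') < m)%N by move: hm c1 c2; rewrite s'; lia.
have := IH ps' hs V'; rewrite s' !big_split /= !sum_pred1 => <-.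
by have := bipA auv; case: (u \in A); case: (v \in A) => // _; rewrite ?addn0 ?addn1 addnS.
Qed.

Lemma sum_card_sym (e : rel G) (S : {set G}) : symmetric e ->
  (\sum_(a in S) deg e a)%N = (\sum_y #|[set a in S | e y a]|)%N.
Proof.
move=> es.
under eq_bigr => a _ do rewrite /deg -sum1dep_card.
under [RHS]eq_bigr => y _ do rewrite -sum1dep_card.
rewrite (exchange_big_dep xpredT) //=; apply: eq_bigr => y _.
by apply: eq_bigl => a; rewrite es.
Qed.

Lemma set_of_Prop (T : finType) (P : T -> Prop) :
  exists S : {set T}, forall a, a \in S <-> P a.
Proof.
have [f hf] : exists f : T -> bool, forall a, f a <-> P a.
  have h a : exists b : bool, b <-> P a.
    by case: (classic (P a)) => h; [exists true|exists false].
  exact: (fin_all_exists h).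
by exists [set a | f a] => a; rewrite inE.
Qed.

End Counting.

(** * Covers reachable by exchanges *)

Section Reach.
Variable G : sgraph.
Variables (A : {set G}) (d k : nat).
Hypothesis bipA : forall x y : G, adj x y -> (x \in A) != (y \in A).
Hypothesis regG : regular d G.
Hypothesis kmin : forall ps : seq (seq G), valid ps -> (k <= size ps)%N.
Hypothesis halfA : (2 * #|A|)%N = #|G|.
Hypothesis d_gt0 : (0 < d)%N.
Implicit Types (ps : seq (seq G)) (x y u v s w : G) (H S : {set G}).

(** [s] is a vertex of [A] of cover degree at most 1 that is not held. *)
Definition token H ps s : Prop := [/\ s \in A, s \notin H & (deg (ev ps) s <= 1)%N].

(** [ps'] is a cover with [k] paths that arises from [ps] by exchanging the edge
[yw] for [sy]. *)
Definition move ps s y w ps' : Prop :=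
  [/\ adj s y /\ ~~ ev ps s y, ev ps y w, valid ps', size ps' = k &
     ev ps' =2 (fun a b => (ev ps a b && ~~ uedge y w a b) || uedge s y a b)].

(** The covers obtained from [ps0] by exchanges whose token is not in [H]. *)
Inductive reach H ps0 : seq (seq G) -> Prop :=
| reach_refl : reach H ps0 ps0
| reach_move ps ps' s y w : reach H ps0 ps -> token H ps s ->
    move ps s y w ps' -> reach H ps0 ps'.

(** Throughout the covers reachable from [ps0], the vertices of [H] keep degree
exactly 1. *)
Definition held H ps0 : Prop :=
  forall ps h, reach H ps0 ps -> h \in H -> deg (ev ps) h = 1%N.

(** [S] is the set of the vertices that are tokens in some cover reachable from
[ps0]. *)
Definition reached_tokens H ps0 S : Prop :=
  forall a, a \in S <-> exists2 ps, reach H ps0 ps & token H ps a.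

Lemma reach_valid H ps0 ps : valid ps0 -> size ps0 = k ->
  reach H ps0 ps -> valid ps /\ size ps = k.
Proof. by move=> V s; elim=> {ps} [|ps ps' a y w _ _ _ []]. Qed.

Lemma move_deg ps s y w ps' x : valid ps -> move ps s y w ps' ->
  (deg (ev ps') x + (x == w))%N = (deg (ev ps) x + (x == s))%N.
Proof.
move=> V [[sy ne] yw _ _ E].
pose e : rel G := fun a b => ev ps a b && ~~ uedge y w a b.
have D1 : deg (ev ps) x = (deg e x + (x == y) + (x == w))%N.
  apply: deg_add_edge; first exact: adj_neq (valid_adj V yw).
  - by rewrite /e uedge_refl andbF.
  - by rewrite /e uedge_sym uedge_refl andbF.
  move=> a b; rewrite /e; case u: (uedge y w a b); last by rewrite andbT orbF.
  by rewrite andbF /=; case: (uedge_or u) => [[-> ->]|[-> ->]] //; rewrite ev_sym.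
have D2 : deg (ev ps') x = (deg e x + (x == s) + (x == y))%N.
  apply: deg_add_edge => //; first exact: adj_neq.
  - by rewrite /e (negbTE ne).
  - by rewrite /e ev_sym (negbTE ne).
by rewrite D1 D2; lia.
Qed.

Lemma move_ends ps s y w ps' : valid ps -> s \in A -> move ps s y w ps' ->
  [/\ w \in A, y \notin A & w != s].
Proof.
move=> V sA [[sy ne] yw _ _ _].
have yA : y \notin A by have := bipA sy; rewrite sA; case: (y \in A).
split=> //; first by have := bipA (valid_adj V yw); rewrite (negbTE yA); case: (w \in A).
by apply: contraNneq ne => <-; rewrite ev_sym.
Qed.

Section Closure.
Variables (H : {set G}) (ps0 : seq (seq G)) (S : {set G}).
Hypotheses (V0 : valid ps0) (size0 : size ps0 = k) (heldH : held H ps0)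
  (tokS : reached_tokens H ps0 S).

(** An exchange takes place inside the set [S] of reached tokens: [w] loses an edge
and so becomes a token, and it is not in [H], where degrees are constant. *)
Lemma move_closed ps s y w ps' : reach H ps0 ps -> token H ps s ->
  move ps s y w ps' -> s \in S /\ w \in S.
Proof.
move=> r t m; split; first by apply/tokS; exists ps.
have [V _] := reach_valid V0 size0 r.
have [sA sH ds] := t.
have [wA yA ws] := move_ends V sA m.
have r' := reach_move r t m.
have := move_deg w V m; rewrite eqxx (negbTE ws) addn0 addn1 => D.
apply/tokS; exists ps' => //; split=> //.
- by apply/negP=> wH; move: D; rewrite (heldH r wH) (heldH r' wH).
- by rewrite -ltnS D; apply: deg_le2.
Qed.

Lemma tokS_sub : S \subset A :\: H.
Proof. by apply/subsetP=> a /tokS[ps _ [aA aH _]]; rewrite !inE aA aH. Qed.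

(** The number of cover neighbours in [S] of a vertex outside [A] is the same in all
reachable covers. *)
Lemma reach_inside ps y : reach H ps0 ps -> y \notin A ->
  #|[set a in S | ev ps y a]| = #|[set a in S | ev ps0 y a]|.
Proof.
move=> r yA; elim: r => {ps} // ps ps' s z w r <- t m.
have [sS wS] := move_closed r t m.
have [V _] := reach_valid V0 size0 r.
have [sA _ _] := t; have [wA zA ws] := move_ends V sA m.
case: m => [[sz ne] zw _ _ E].
have neqA b c : b \in A -> c \notin A -> (b == c) = false.
  by move=> bA; apply: contraNF => /eqP <-.
case: (eqVneq y z) => [->|yz].
  have -> : [set a in S | ev ps' z a] = s |: ([set a in S | ev ps z a] :\ w).
    apply/setP=> a; rewrite !inE E /uedge !xpair_eqE eqxx /=.
    rewrite ![z == _]eq_sym (neqA w z) // (neqA s z) //= orbF.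
    case: (eqVneq a s) => [->|]; first by rewrite sS orbT.
    by case: (eqVneq a w) => //= _ _; rewrite ?andbF ?andbT ?orbF.
  rewrite cardsU1 !inE eq_sym (negbTE ws) /= sS ev_sym (negbTE ne) /=.
  by rewrite [RHS](cardsD1 w) !inE wS zw.
congr #|pred_of_set _|; apply/setP=> a; rewrite !inE E /uedge !xpair_eqE.
rewrite (negbTE yz) /= [y == w]eq_sym (neqA w y) // [y == s]eq_sym (neqA s y) //=.
by rewrite andbT orbF.
Qed.

(** In [ps0] the vertices of [H] have degree 1 and those of [A] outside [S] and [H]
have degree 2. *)
Lemma sum_deg_tokens t : (#|H| + t)%N = k -> H \subset A ->
  (\sum_(a in S) deg (ev ps0) a + t)%N = (2 * #|S|)%N.
Proof.
move=> hk HA.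
have := sum_deg bipA V0; rewrite size0 -halfA.
have SA : S \subset A by apply: subset_trans tokS_sub (subsetDl _ _).
have SH : S \subset ~: H.
  by apply/subsetP=> a /(subsetP tokS_sub); rewrite !inE => /andP[].
rewrite (big_setID H) /= (setIidPr HA).
rewrite (eq_bigr (fun=> 1%N)) => [|h hH]; last exact: heldH (reach_refl _ _) hH.
rewrite sum1_card (big_setID S) /= (setIidPr tokS_sub).
rewrite [X in (_ + (_ + X))%N](eq_bigr (fun=> 2%N)) => [|h]; last first.
  rewrite !inE => /and3P[hS hH hA]; apply/eqP; rewrite eqn_leq deg_le2 //= ltnNge.
  apply: contra hS => dh; apply/tokS; exists ps0; [exact: reach_refl|by split].
rewrite sum_nat_const.
have := cardsID S (A :\: H); rewrite (setIidPr tokS_sub).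
have := cardsID H A; rewrite (setIidPr HA).
move: hk; set x := (\sum_(_ in _) _)%N; move: #|_ :\: S| => z; lia.
Qed.

Lemma card_adj_tokens : (\sum_y #|[set a in S | adj y a]|)%N = (d * #|S|)%N.
Proof.
rewrite -sum_card_sym; last exact: adj_sym.
by rewrite (eq_bigr (fun=> d)) ?sum_nat_const ?(mulnC d) // => a _; apply: regG.
Qed.

(** Otherwise, summing over [y], the degree sums of [sum_deg_tokens] and
[card_adj_tokens] would contradict each other. *)
Lemma rich_vertex t : (#|H| + t.+1)%N = k -> H \subset A ->
  exists y, (d * #|[set a in S | ev ps0 y a]| < 2 * #|[set a in S | adj y a]|)%N.
Proof.
move=> hk HA; apply: NNPP => nex.
have := sum_deg_tokens hk HA; rewrite sum_card_sym; last exact: ev_sym.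
have : (\sum_y 2 * #|[set a in S | adj y a]| <=
        \sum_y d * #|[set a in S | ev ps0 y a]|)%N.
  by apply: leq_sum => y _; rewrite leqNgt; apply/negP=> hy; apply: nex; exists y.
rewrite -!big_distrr /= card_adj_tokens; set x := (\sum_y _)%N => h1 h2.
have : (2 * (d * #|S|) + d * t.+1 <= d * (x + t.+1))%N by rewrite mulnDr leq_add2r.
by rewrite h2; move: d_gt0; nia.
Qed.

(** When a neighbour [s] of [y] is a token of a reachable cover, either [sy] is an
edge of that cover or an exchange removes an edge [yw] with [w] in [S]. *)
Lemma token_nbr_reached y s : s \in S -> adj y s ->
  (0 < #|[set a in S | ev ps0 y a]|)%N.
Proof.
move=> sS ys; have [ps r t] := (tokS s).1 sS.
have [sA sH ds] := t.
have yA : y \notin A by have := bipA ys; rewrite sA; case: (y \in A).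
have [V sz] := reach_valid V0 size0 r.
rewrite -(reach_inside r yA) card_gt0; apply/set0Pn.
case e: (ev ps s y); first by exists s; rewrite !inE sS ev_sym.
have sy : adj s y by rewrite adj_sym.
case: (rotate V sy (negbT e) ds) => [[w [ps' [yw V' s' E']]]|[ps' [V' s']]].
  have m : move ps s y w ps' by split; rewrite ?e ?s'.
  by exists w; rewrite !inE yw (move_closed r t m).2.
by have := leq_ltn_trans (kmin V') s'; rewrite sz ltnn.
Qed.

Lemma rich_vertex_bounds y :
  (d * #|[set a in S | ev ps0 y a]| < 2 * #|[set a in S | adj y a]|)%N ->
  #|[set a in S | ev ps0 y a]| = 1%N /\ (d < 2 * #|[set a in S | adj y a]|)%N.
Proof.
move=> h; have [s] : exists s, s \in [set a in S | adj y a].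
  by apply/set0Pn; rewrite -card_gt0; move: h; lia.
rewrite inE => /andP[sS ys].
have f0 := token_nbr_reached sS ys.
have e1 : (#|[set a in S | adj y a]| <= d)%N.
  rewrite -(regG y); apply: subset_leq_card; apply/subsetP=> a.
  by rewrite !inE => /andP[].
by move: h f0 e1; move: #|[set a in S | ev ps0 y a]| => f; nia.
Qed.

(** [K] is the cover [ps] without the edge from [y] to its neighbour outside [S], if
there is one.  A token adjacent to [y] on another path of [K] could be joined to
[y], which would be an exchange of an edge leaving [S], or would give a cover
with fewer than [k] paths. *)
Lemma tokens_same_list y ps : y \notin A -> reach H ps0 ps ->
  #|[set a in S | ev ps0 y a]| = 1%N ->
  exists K, [/\ valid K, (deg (ev K) y <= 1)%N,
    forall x, (deg (ev K) x <= deg (ev ps) x)%N &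
    forall s, token H ps s -> adj s y -> same K s y].
Proof.
move=> yA r f1; have [V sz] := reach_valid V0 size0 r.
case: (classic (exists c, ev ps y c /\ c \notin S)) => [[c [yc cS]]|nc].
  case: (split_edge V yc) => K [VK sK EK nK _].
  have n1 : ~~ ev K y c by apply: contra nK; apply: ev_same.
  have n2 : ~~ ev K c y by rewrite ev_sym.
  have yc' := adj_neq (valid_adj V yc).
  have D x := deg_add_edge x yc' n1 n2 EK.
  have dy : (deg (ev K) y <= 1)%N.
    by have := deg_le2 y V; rewrite D eqxx (negbTE yc') addn0 addn1.
  have dK x : (deg (ev K) x <= deg (ev ps) x)%N by rewrite D -addnA leq_addr.
  exists K; split=> // s t sy; apply/negPn/negP=> ns.
  have [sA _ ds] := t.
  case: (join_edge VK sy (leq_trans (dK s) ds) dy ns) => ps' [V' s' E'].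
  have nsc : s != c by apply: contraNneq cS => <-; apply/tokS; exists ps.
  have m : move ps s y c ps'.
    split=> //; first split=> //.
    - rewrite EK; apply/norP; split; first by apply: contra ns; apply: ev_same.
      apply/negP=> /uedge_or[[e _]|[e _]]; last by rewrite e eqxx in nsc.
      by rewrite -e sA in yA.
    - by apply/eqP; rewrite -eqSS s' sK sz.
    move=> a b; rewrite E' EK; congr (_ || _).
    case u: (uedge y c a b); last by rewrite orbF andbT.
    rewrite orbT andbF.
    by case: (uedge_or u) => [[-> ->]|[-> ->]]; apply: negbTE.
  by have [_] := move_closed r t m; rewrite (negbTE cS).
have dy : (deg (ev ps) y <= 1)%N.
  rewrite -f1 -(reach_inside r yA); apply: subset_leq_card; apply/subsetP=> a.
  rewrite !inE => ya; rewrite ya andbT; apply/negPn/negP=> aS.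
  by apply: nc; exists a.
exists ps; split=> // s [sA sH ds] sy; apply/negPn/negP=> ns.
case: (join_edge V sy ds dy ns) => ps' [V' s' _].
by have := kmin V'; rewrite -sz -s' ltnn.
Qed.

(** Two such tokens and [y] would be three ends of one path of [K]. *)
Lemma token_nbr_unique y ps s a : y \notin A -> reach H ps0 ps ->
  #|[set a in S | ev ps0 y a]| = 1%N ->
  token H ps s -> token H ps a -> adj s y -> adj a y -> s = a.
Proof.
move=> yA r f1 ts ta sy ay.
have [K [VK dy dK sK]] := tokens_same_list yA r f1.
have [_ _ ds] := ts; have [_ _ da] := ta.
apply/eqP/negPn/negP=> sa.
apply: (ends_same_list VK dy (leq_trans (dK s) ds) (leq_trans (dK a) da)).
- by rewrite same_sym sK.
- by rewrite same_sym sK.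
- by rewrite eq_sym adj_neq.
- by rewrite eq_sym adj_neq.
- by [].
Qed.

(** A token of degree 0 would be alone on its path of [K]. *)
Lemma token_nbr_deg y ps s : y \notin A -> reach H ps0 ps ->
  #|[set a in S | ev ps0 y a]| = 1%N ->
  token H ps s -> adj s y -> deg (ev ps) s = 1%N.
Proof.
move=> yA r f1 ts sy.
have [K [VK dy dK sK]] := tokens_same_list yA r f1.
have [_ _ ds] := ts; apply/eqP; rewrite eqn_leq ds lt0n; apply/eqP=> d0.
have dK0 : deg (ev K) s = 0%N by apply/eqP; rewrite -leqn0 -d0.
by have := adj_neq sy; rewrite (isolated VK dK0 (sK s ts sy)) eqxx.
Qed.

End Closure.

Lemma exists_reached_tokens H ps0 : exists S, reached_tokens H ps0 S.
Proof. exact: set_of_Prop. Qed.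

(** Once held, the vertex [s] is not used in an exchange as the vertex that gains
an edge, so it remains an end. *)
Lemma reach_held_more H ps0 ps1 ps s : reach H ps0 ps1 -> token H ps1 s ->
  valid ps0 -> size ps0 = k ->
  reach (s |: H) ps1 ps -> reach H ps0 ps /\ token H ps s.
Proof.
move=> r1 t1 V0 s0; elim=> {ps} [//|ps ps' a y w _ [r [sA sH ds]] t m].
have t' : token H ps a.
  by case: t => aA aH da; split=> //; apply: contra aH => aH; rewrite !inE aH orbT.
have r' := reach_move r t' m; split=> //; split=> //.
have [V _] := reach_valid V0 s0 r.
have := move_deg s V m; case: t => _ aH _.
have -> : (s == a) = false by apply: contraNF aH => /eqP->; rewrite !inE eqxx.
by rewrite addn0 => D; apply: leq_trans ds; rewrite -D leq_addr.
Qed.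

(** The inductive claim, where [t] is the number of paths minus the number of held
vertices.  The induction holds one more token adjacent to a vertex [y] given by
[rich_vertex]. *)
Lemma many_tokens t H ps0 S : valid ps0 -> size ps0 = k -> held H ps0 ->
  H \subset A -> (#|H| + t)%N = k -> reached_tokens H ps0 S ->
  (t * d.+1 <= 2 * #|S|)%N.
Proof.
elim: t H ps0 S => // t IH H ps0 S V0 s0 hH HA hk tS.
have [y] := rich_vertex V0 s0 hH tS hk HA.
case/(rich_vertex_bounds V0 s0 hH tS) => f1 e1.
have [s] : exists s, s \in [set a in S | adj y a].
  by apply/set0Pn; rewrite -card_gt0; move: e1; lia.
rewrite inE => /andP[sS ys]; have sy : adj s y by rewrite adj_sym.
have [ps1 r1 t1] := (tS s).1 sS; have [sA sH _] := t1.
have yA : y \notin A by have := bipA ys; rewrite sA; case: (y \in A).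
have [V1 s1] := reach_valid V0 s0 r1.
have more ps : reach (s |: H) ps1 ps -> reach H ps0 ps /\ token H ps s.
  exact: reach_held_more.
have held' : held (s |: H) ps1.
  move=> ps h /more[r ts]; rewrite !inE => /orP[/eqP->|]; last exact: hH.
  exact: (token_nbr_deg V0 s0 hH tS yA r).
(* Hold [s] from now on; the tokens still reachable avoid the neighbours of [y]. *)
have [S' tS'] := exists_reached_tokens (s |: H) ps1.
have HA' : s |: H \subset A by rewrite subUset sub1set sA.
have hk' : (#|s |: H| + t)%N = k by rewrite cardsU1 sH add1n addSnnS.
have := IH _ _ _ V1 s1 held' HA' hk' tS'.
have : (#|S'| <= #|S :\: [set a in S | adj y a]|)%N.
  apply: subset_leq_card; apply/subsetP=> a /tS'[ps /more[r ts]] [aA].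
  rewrite !inE negb_or => /andP[as_ aH] da.
  have ta : token H ps a by [].
  have aS : a \in S by apply/tS; exists ps.
  rewrite aS andbT /=; apply: contra as_ => ya.
  by rewrite (token_nbr_unique V0 s0 hH tS yA r f1 ts ta) // adj_sym.
have := cardsID [set a in S | adj y a] S.
rewrite (setIidPr _); last by apply/subsetP=> a; rewrite inE => /andP[].
by move: e1; rewrite mulSn; clear; lia.
Qed.

End Reach.

(** * Small path covers of regular bipartite graphs *)

Section Final.
Variable G : sgraph.
Implicit Types (ps : seq (seq G)).

Lemma balanced d (A : {set G}) : (0 < d)%N -> regular d G ->
  (forall x y : G, adj x y -> (x \in A) != (y \in A)) -> (2 * #|A|)%N = #|G|.
Proof.
move=> d0 reg bip.
have := sum_card_sym A (@adj_sym G).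
rewrite (eq_bigr (fun=> d)) => [|a _]; last exact: reg.
rewrite [RHS](bigID (mem A)) /= [X in _ = (X + _)%N]big1 => [|y yA]; last first.
  apply/eqP; rewrite cards_eq0; apply/eqP/setP=> a; rewrite !inE.
  by apply/negbTE/negP=> /andP[aA /bip]; rewrite aA yA.
rewrite add0n [RHS](eq_bigr (fun=> d)) => [|y yA]; last first.
  rewrite -(reg y); apply: eq_card => a; rewrite !inE.
  case ya: (adj y a); last by rewrite andbF.
  by have := bip _ _ ya; rewrite (negbTE yA) andbT; case: (a \in A).
have -> : (\sum_(y | y \notin A) d)%N = (\sum_(y in ~: A) d)%N.
  by apply: eq_bigl => y; rewrite inE.
rewrite !sum_nat_const => /eqP; rewrite eqn_pmul2r // => /eqP e.
by rewrite -(cardsC A) -e mul2n addnn.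
Qed.

Lemma valid_singletons : valid [seq [:: x] | x <- enum G].
Proof.
have f : flatten [seq [:: x] | x <- enum G] = enum G by elim: (enum G) => //= a s ->.
rewrite /valid f enum_uniq; apply/and4P; split=> //.
- by apply/negP=> /mapP[].
- by apply/forallP=> x; rewrite mem_enum.
- by apply/allP=> p /mapP[x _ ->].
Qed.

(** A cover with the least number of paths. *)
Lemma min_cover : exists2 ps : seq (seq G),
  valid ps & forall ps', valid ps' -> (size ps <= size ps')%N.
Proof.
have h := valid_singletons.
move: h; move: [seq _ | _ <- _] => ps.
have [m] := ubnP (size ps); elim: m ps => // m IH ps hm V.
case: (classic (exists2 ps' : seq (seq G), valid ps' & (size ps' < size ps)%N))
  => [[ps' V' s']|n].
  by apply: (IH ps') => //; exact: leq_trans s' hm.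
exists ps => // ps' V'; rewrite leqNgt; apply/negP=> s'; apply: n; by exists ps'.
Qed.

Lemma small_cover d : regular d G -> bipartite G ->
  exists2 ps : seq (seq G), valid ps & (size ps * d.+1 <= #|G|)%N.
Proof.
move=> reg [A bip]; have [ps V mn] := min_cover; exists ps => //.
(* For [d = 0] any cover will do, as it has at most |G| paths. *)
case: (posnP d) => [->|d0]; first by rewrite muln1 -(size_cover V) leq_addl.
have hA := balanced d0 reg bip.
have [S tS] := exists_reached_tokens A (size ps) set0 ps.
have h0 : held A (size ps) set0 ps by move=> ? h _; rewrite inE.
have hk : (#|(set0 : {set G})| + size ps)%N = size ps by rewrite cards0.
apply: leq_trans (many_tokens bip reg mn hA d0 V erefl h0 (sub0set A) hk tS) _.
rewrite -hA leq_pmul2l //; apply: subset_leq_card.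
by apply: subset_trans (tokS_sub tS) _; apply: subsetDl.
Qed.

Lemma sub_steps_sorted (e : rel G) p :
  (forall x y, (x, y) \in steps p -> e x y) -> sorted e p.
Proof.
case: p => // x p; elim: p x => //= y p IH x h; rewrite h ?inE ?eqxx //=.
by apply: IH => a b ab; apply: h; rewrite /steps /= inE ab orbT.
Qed.

Lemma n_comp_cover ps (a : {pred G}) : valid ps -> (n_comp (ev ps) a <= size ps)%N.
Proof.
move=> V; set e := ev ps.
have sc : connect_sym e by apply: sym_connect_sym; apply: ev_sym.
pose hs := pmap (fun p => omap (fingraph.root e) (ohead p)) ps.
apply: (@leq_trans (size hs)); last by rewrite size_pmap; apply: count_size.
apply: leq_trans (card_size _); apply: subset_leq_card; apply/subsetP=> x.
rewrite !inE => /andP[rx _].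
case: (valid_mem x V) => [[|h p] ip xp] //.
rewrite mem_pmap; apply/mapP; exists (h :: p) => //=; congr Some.
rewrite -(eqP rx); apply/eqP; rewrite (root_connect sc).
rewrite sc; apply: (@path_connect _ e h p) => //.
apply: (@sub_steps_sorted e (h :: p)) => u v /stepsP[l [r E]].
by apply: (@ev_infix _ _ l r); rewrite -E.
Qed.

End Final.

Local Open Scope ring_scope.

Theorem theorem2p7 (d n : nat) (n_ge1 : (1 <= n)%N) (G : sgraph)
    (card_G : #|G| = n) (reg_G : regular d G) (bip_G : bipartite G) :
  exists F : subgraph G,
    [/\ spanning F, linear_forest F
      & (num_paths F)%:R <= n%:R / (d%:R + 1) :> rat].
Proof.
have [ps V hs] := small_cover reg_G bip_G.
exists (@Subgraph G [set: G] (ev ps) (@ev_sym _ ps)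
  (fun x y => @valid_adj G ps x y V) (fun x y _ => in_setT x)).
split=> //.
  exists ps; split=> //; [exact: valid_nil|exact: valid_uniq|].
  by move=> x; rewrite inE; case/and4P: V => _ _ /forallP ->.
rewrite natr1.
rewrite ler_pdivlMr ?ltr0n // -natrM ler_nat -card_G.
apply: leq_trans hs; rewrite leq_mul2r n_comp_cover ?orbT //.
Qed.
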